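(* Let $N$ be a matroid on the finite set $E$, let $H$ be a skew hyperfield, let $[.]:A_N\to H$ be a map, and let $\mathcal{C}\subseteq H^E$. The following are equivalent: (1) $M=(E,\mathcal{C})$ is a left $H$-matroid such that $\underline{M}=N$, and $[.]=[.]_{\mathcal{C}}$. (2) $[.]$ are left quasi-Plücker coordinates for $N$, and $\mathcal{C}=\mathcal{C}_{[.]}$.
   Context: **Skew hyperfields.** A skew hyperfield is a tuple $(H,\cdot,\boxplus,1,0)$ with $0\neq 1$, where $\boxplus:H\times H\to 2^H\setminus\{\emptyset\}$ is commutative and associative (for subsets, $X\boxplus Y=\bigcup_{x\in X,y\in Y}x\boxplus y$; elements are identified with singletons), such that: $x\boxplus 0=\{x\}$; for each $x$ there is a unique element $-x$ with $0\in x\boxplus(-x)$; $x\in y\boxplus z$ iff $z\in x\boxplus(-y)$; $H^\star:=H\setminus\{0\}$ is a (not necessarily commutative) group under $\cdot$ with identity $1$; $0\cdot x=x\cdot 0=0$; $\alpha(x\boxplus y)=\alpha x\boxplus\alpha y$ and $(x\boxplus y)\alpha=x\alpha\boxplus y\alpha$. **Left $H$-matroids.** For $X\in H^E$ put $\underline{X}:=\{e\in E:X_e\neq 0\}$, and $\underline{\mathcal{C}}:=\{\underline{X}:X\in\mathcal{C}\}$. Two distinct members $C,C'$ of a collection of subsets of $E$ form a modular pair if $C\cup C'$ does not properly contain the union of two distinct members of that collection; $X,Y\in\mathcal{C}$ are modular if $\underline{X},\underline{Y}$ form a modular pair in $\underline{\mathcal{C}}$. A left $H$-matroid is a pair $(E,\mathcal{C})$,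 $\mathcal{C}\subseteq H^E$, with (C0) $0\notin\mathcal{C}$; (C1) if $X\in\mathcal{C}$, $\alpha\in H^\star$, then $\alpha X\in\mathcal{C}$; (C2) if $X,Y\in\mathcal{C}$ and $\underline{X}\subseteq\underline{Y}$, then $Y=\alpha X$ for some $\alpha\in H^\star$; (C3) if $X,Y\in\mathcal{C}$ are modular and $e\in E$ is such that $X_e=-Y_e\neq 0$, then there is $Z\in\mathcal{C}$ with $Z_e=0$ and $Z_f\in X_f\boxplus Y_f$ for all $f\in E$. Its underlying matroid is $\underline{M}=(E,\underline{\mathcal{C}})$, the matroid with set of circuits $\underline{\mathcal{C}}$. **Coordinates.** $Fab$ denotes $F\cup\{a,b\}$ where it is implicit that $a,b$ are distinct elements of $E\setminus F$ (similarly $Fa$, $Fabc$, etc.). For a matroid $N$ with set of bases $\mathcal{B}$, $A_N:=\{(B,B')\in\mathcal{B}\times\mathcal{B}:|B\setminus B'|=1\}$. Given $\mathcal{C}$ satisfying (C0)–(C2) such that $\underline{\mathcal{C}}$ is the set of circuits of $N$, $[.]_{\mathcal{C}}:A_N\to H$ is defined by $[Fa,Fb]_{\mathcal{C}}:=-X_a^{-1}X_b$ for any $X\in\mathcal{C}$ with $\underline{X}\subseteq Fab$ (this is well defined). Given $[.]:A_N\to H$, $\mathcal{C}_{[.]}$ is the set of all $X\in H^E$ such that $\underline{X}$ is a circuit of $N$ and $X_a^{-1}X_b=-[Fa,Fb]$ whenever $a,b\in\underline{X}\subseteq Fab$ and $Fa,Fb\in\mathcal{B}$. A map $[.]:A_N\to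 H$ are left quasi-Plücker coordinates for $N$ if (P0) $[Fa,Fb]\cdot[Fb,Fa]=1$ if $Fa,Fb\in\mathcal{B}$; (P1) $[Fac,Fbc]\cdot[Fab,Fac]\cdot[Fbc,Fab]=-1$ if $Fab,Fac,Fbc\in\mathcal{B}$; (P2) $[Fa,Fb]\cdot[Fb,Fc]\cdot[Fc,Fa]=1$ if $Fa,Fb,Fc\in\mathcal{B}$; (P3) $[Fac,Fbc]=[Fad,Fbd]$ if $Fac,Fad,Fbc,Fbd\in\mathcal{B}$, and $Fab\notin\mathcal{B}$ or $Fcd\notin\mathcal{B}$; (P4) $1\in[Fbd,Fab]\cdot[Fac,Fcd]\boxplus[Fad,Fab]\cdot[Fbc,Fcd]$ if $Fac,Fad,Fbc,Fbd,Fab,Fcd\in\mathcal{B}$. *)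

(* Defs.v *)
(* MathComp world, with the classical sets of MathComp-Analysis. *)
From HB Require Import structures.
From mathcomp Require Import all_boot.
From mathcomp Require Import boolp classical_sets.

Set Implicit Arguments.
Unset Strict Implicit.
Unset Printing Implicit Defensive.

Declare Scope hyper_scope.
Delimit Scope hyper_scope with H.
Local Open Scope classical_set_scope.

Definition set_hadd (H : Type) (add : H -> H -> set H) (X Y : set H) : set H :=
  \bigcup_(x in X) \bigcup_(y in Y) add x y.

(* [hopp] and [hinv] are part of the data only for convenience: the axioms
   determine [hopp] everywhere and [hinv] on nonzero elements. The value of
   [hinv] at zero is irrelevant and left unspecified. *)
HB.mixin Record isSkewHyperfield (H : Type) := {
  hzero : H;
  hone : H;
  hadd : H -> H -> set H;
  hopp : H -> H;
  hmul : H -> H -> H;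
  hinv : H -> H;
  hzero_neq_hone : hzero <> hone;
  hadd_neq0 : forall x y, hadd x y !=set0;
  haddC : forall x y, hadd x y = hadd y x;
  haddA : forall x y z,
    set_hadd hadd [set x] (hadd y z) = set_hadd hadd (hadd x y) [set z];
  haddx0 : forall x, hadd x hzero = [set x];
  hadd_opp : forall x y, hadd x y hzero <-> y = hopp x;
  hadd_rev : forall x y z, hadd y z x <-> hadd x (hopp y) z;
  hmul_neq0 : forall x y, x <> hzero -> y <> hzero -> hmul x y <> hzero;
  hmulA : forall x y z, hmul x (hmul y z) = hmul (hmul x y) z;
  hmul1x : forall x, hmul hone x = x;
  hmulx1 : forall x, hmul x hone = x;
  hmulVx : forall x, x <> hzero -> hmul (hinv x) x = hone;
  hmulxV : forall x, x <> hzero -> hmul x (hinv x) = hone;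
  hmul0x : forall x, hmul hzero x = hzero;
  hmulx0 : forall x, hmul x hzero = hzero;
  hmulDr : forall a x y, hmul a @` hadd x y = hadd (hmul a x) (hmul a y);
  hmulDl : forall a x y, hmul^~ a @` hadd x y = hadd (hmul x a) (hmul y a)
}.

#[short(type="skewHyperfieldType")]
HB.structure Definition SkewHyperfield := { H of isSkewHyperfield H }.

Notation "0" := hzero : hyper_scope.
Notation "1" := hone : hyper_scope.
Notation "- x" := (hopp x) : hyper_scope.
Notation "x * y" := (hmul x y) : hyper_scope.
Notation "x ^-1" := (hinv x) : hyper_scope.
Notation "x [+] y" := (hadd x y) (at level 50, left associativity) : hyper_scope.
Local Open Scope hyper_scope.

Record matroid (E : finType) := Matroid {
  bases : {set {set E}};
  bases_neq0 : bases != finset.set0;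
  bases_exchange : forall B B' x, B \in bases -> B' \in bases ->
    x \in B :\: B' -> exists2 y, y \in B' :\: B & y |: (B :\ x) \in bases
}.

Definition indep (E : finType) (N : matroid E) (I : {set E}) : bool :=
  [exists B in bases N, I \subset B].

Definition circuits (E : finType) (N : matroid E) : {set {set E}} :=
  [set D : {set E} | minset (fun A => ~~ indep N A) D]%SET.

Section HMatroids.
Variables (E : finType) (H : skewHyperfieldType).
Implicit Types (X Y Z : {ffun E -> H}) (C : set {ffun E -> H}).

Definition supp X : {set E} := [set e | `[< X e <> 0 >]]%SET.

Definition supports C : set {set E} := supp @` C.

Definition lscale (a : H) X : {ffun E -> H} := [ffun e => a * X e].

Definition modular_pair (S : set {set E}) (D D' : {set E}) : Prop :=
  [/\ S D, S D', D <> D' &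
      ~ exists A A' : {set E},
          [/\ S A, S A', A <> A' & A :|: A' \proper D :|: D'] ]%SET.

Record left_matroid C : Prop := LeftMatroid {
  left_matroid_C0 : ~ C [ffun=> 0];
  left_matroid_C1 : forall X (a : H), C X -> a <> 0 -> C (lscale a X);
  left_matroid_C2 : forall X Y, C X -> C Y -> supp X \subset supp Y ->
    exists2 a : H, a <> 0 & Y = lscale a X;
  left_matroid_C3 : forall X Y (e : E), C X -> C Y ->
    modular_pair (supports C) (supp X) (supp Y) ->
    X e = - Y e -> X e <> 0 ->
    exists Z, [/\ C Z, Z e = 0 & forall f, (X f [+] Y f) (Z f)]
}.

Variable N : matroid E.

Definition adjacent (p : {set E} * {set E}) : bool :=
  [&& p.1 \in bases N, p.2 \in bases N & #|p.1 :\: p.2| == 1%N].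

Definition adjacent_bases : Type := {p : {set E} * {set E} | adjacent p}.

Implicit Type q : adjacent_bases -> H.

(* [coord q B B'] is [q] at the pair (B, B'); the default value 0 is only
   reached when (B, B') is not in the domain of [q]. *)
Definition coord q (B B' : {set E}) : H :=
  if insub (B, B') is Some p then q p else 0.

(* The elements listed in [s] are pairwise distinct and lie outside [F], as is
   implicit in juxtapositions such as Fab. *)
Definition fresh (F : {set E}) (s : seq E) : bool :=
  uniq s && all (fun x => x \notin F) s.

Definition ext (F : {set E}) (s : seq E) : {set E} := (F :|: [set:: s])%SET.

Definition coords_values C (p : adjacent_bases) : set H :=
  [set h | exists (F : {set E}) (a b : E) X,
     [/\ fresh F [:: a; b], val p = (ext F [:: a], ext F [:: b]),
         C X, supp X \subset ext F [:: a; b] & h = - ((X a)^-1 * X b)] ].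

(* When [supports C] is the set of circuits of [N] and (C0)-(C2) hold,
   [coords_values C p] is a singleton and [coords_of] picks its element;
   [xget] needs a choiceType, whence the cast to [{classic H}]. *)
Definition coords_of C : adjacent_bases -> H :=
  fun p => @xget {classic H} (0 : H) (coords_values C p).

Definition circuits_of_coords q : set {ffun E -> H} :=
  [set X | supp X \in circuits N /\
     forall (F : {set E}) (a b : E), fresh F [:: a; b] ->
       a \in supp X -> b \in supp X -> supp X \subset ext F [:: a; b] ->
       ext F [:: a] \in bases N -> ext F [:: b] \in bases N ->
       (X a)^-1 * X b = - coord q (ext F [:: a]) (ext F [:: b])].

Record quasi_Plucker q : Prop := QuasiPlucker {
  quasi_Plucker_P0 : forall (F : {set E}) (a b : E), fresh F [:: a; b] ->
    ext F [:: a] \in bases N -> ext F [:: b] \in bases N ->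
    coord q (ext F [:: a]) (ext F [:: b])
      * coord q (ext F [:: b]) (ext F [:: a]) = 1;
  quasi_Plucker_P1 : forall (F : {set E}) (a b c : E),
    fresh F [:: a; b; c] ->
    ext F [:: a; b] \in bases N -> ext F [:: a; c] \in bases N ->
    ext F [:: b; c] \in bases N ->
    coord q (ext F [:: a; c]) (ext F [:: b; c])
      * coord q (ext F [:: a; b]) (ext F [:: a; c])
      * coord q (ext F [:: b; c]) (ext F [:: a; b]) = - hone;
  quasi_Plucker_P2 : forall (F : {set E}) (a b c : E),
    fresh F [:: a; b; c] ->
    ext F [:: a] \in bases N -> ext F [:: b] \in bases N ->
    ext F [:: c] \in bases N ->
    coord q (ext F [:: a]) (ext F [:: b])
      * coord q (ext F [:: b]) (ext F [:: c])
      * coord q (ext F [:: c]) (ext F [:: a]) = 1;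
  quasi_Plucker_P3 : forall (F : {set E}) (a b c d : E),
    fresh F [:: a; b; c; d] ->
    ext F [:: a; c] \in bases N -> ext F [:: a; d] \in bases N ->
    ext F [:: b; c] \in bases N -> ext F [:: b; d] \in bases N ->
    ext F [:: a; b] \notin bases N \/ ext F [:: c; d] \notin bases N ->
    coord q (ext F [:: a; c]) (ext F [:: b; c])
      = coord q (ext F [:: a; d]) (ext F [:: b; d]);
  quasi_Plucker_P4 : forall (F : {set E}) (a b c d : E),
    fresh F [:: a; b; c; d] ->
    ext F [:: a; c] \in bases N -> ext F [:: a; d] \in bases N ->
    ext F [:: b; c] \in bases N -> ext F [:: b; d] \in bases N ->
    ext F [:: a; b] \in bases N -> ext F [:: c; d] \in bases N ->
    (coord q (ext F [:: b; d]) (ext F [:: a; b])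
       * coord q (ext F [:: a; c]) (ext F [:: c; d])
     [+] coord q (ext F [:: a; d]) (ext F [:: a; b])
       * coord q (ext F [:: b; c]) (ext F [:: c; d])) 1
}.

End HMatroids.

(* Main.v *)
Require Import Defs.
From mathcomp Require Import all_boot.
From mathcomp Require Import boolp classical_sets.
From mathcomp Require Import fintype finset.

(** Everything happens inside sets [T] that exceed a basis by one or two
    elements. If [T] exceeds a basis by one element, it contains exactly one
    circuit, and this circuit is [{ x in T | T :\ x is a basis }]
    ([mem_circuitE]). Hence a coordinate at a pair of adjacent bases
    [(T :\ b, T :\ a)] is the ratio of two entries, at [a] and [b], of the
    circuit vector that lives in [T]; a vector whose ratios are all given by
    [q] in this way is called [compatible] with [q] below. The ratios of a
    compatible vector determine it up to a left factor, since every two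
    elements of a circuit [D] are exchanged by some pair of adjacent bases with
    union containing [D] ([circuit_frame]).

    From a matroid to coordinates, (P0) and (P1) only compare entries of one
    vector. In (P2), (P3) and (P4), up to four circuits lie in a set [T] of
    corank 2. There every two distinct circuits form a modular pair
    ([corank2_modular]), so one of them can be eliminated against the other at
    a common element; the result lives in a smaller set, where it has to be the
    vector of the unique circuit. The entries at which only one of the two
    vectors is nonzero are inherited unchanged, and this is (P2) and (P3); an
    entry at which both are nonzero gives the hypersum in (P4).

    From coordinates to a matroid, the entries of a vector supported by a
    circuit [D] are prescribed by coordinates. They do not depend on the set
    [T] that is used to read them, because two choices of [T] are linked by
    basis exchanges to each of which (P3) applies ([coord_indep]); (P0) and
    (P1) then say that all ratios in the vector are right
    ([vector_of_circuit]). For the elimination axiom, let [X], [Y] be modular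
    with [X e = - Y e]. The union [S] of their supports has corank 2, and
    [S :\ e] contains a single circuit; let [Z] be its vector, scaled so that
    it agrees with [X] at some [a] in the support of [X] and not of [Y]. Fix
    also [b] in the support of [Y] and not of [X]. Three circuits that pairwise share [a],
    [b] and [e] are tied together by (P2) ([triangle]), and this determines
    [Z f] for every [f] that is missing from one of them. At an element [f]
    common to all three, (P4) for [a], [b], [e], [f] is exactly
    [Z f \in X f [+] Y f] ([tetrahedron]). *)

Set Implicit Arguments.
Unset Strict Implicit.
Unset Printing Implicit Defensive.

Local Open Scope set_scope.
Local Open Scope hyper_scope.

(** * Arithmetic in a skew hyperfield *)

Section Arithmetic.
Variable H : skewHyperfieldType.
Implicit Types a x y z : H.

Lemma hopp_uniq x y : (x [+] y) 0 -> y = - x.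
Proof. by move/hadd_opp. Qed.

Lemma haddxN x : (x [+] - x) 0.
Proof. exact/hadd_opp. Qed.

Lemma hoppK x : - - x = x.
Proof. by symmetry; apply: hopp_uniq; rewrite haddC; apply: haddxN. Qed.

Lemma hopp0 : - (0 : H) = 0.
Proof. by symmetry; apply: hopp_uniq; rewrite haddx0. Qed.

Lemma hopp_neq0 x : x <> 0 -> - x <> 0.
Proof. by move=> x0 Nx0; apply: x0; rewrite -(hoppK x) Nx0 hopp0. Qed.

Lemma haddx0E x z : (x [+] 0) z <-> z = x.
Proof. by rewrite haddx0. Qed.

Lemma hadd0xE x z : (0 [+] x) z <-> z = x.
Proof. by rewrite haddC haddx0. Qed.

Lemma hadd_scale a x y z : (x [+] y) z -> (a * x [+] a * y) (a * z).
Proof. by move=> xyz; rewrite -hmulDr; exists z. Qed.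

Lemma hmulxN a x : a * - x = - (a * x).
Proof.
by apply: hopp_uniq; have := hadd_scale a (haddxN x); rewrite hmulx0.
Qed.

Lemma hmulNx a x : - a * x = - (a * x).
Proof.
apply: hopp_uniq; rewrite -hmulDl; exists 0; first exact: haddxN.
exact: hmul0x.
Qed.

Lemma hmulKx a x : a <> 0 -> a^-1 * (a * x) = x.
Proof. by move=> a0; rewrite hmulA hmulVx // hmul1x. Qed.

Lemma hmulVKx a x : a <> 0 -> a * (a^-1 * x) = x.
Proof. by move=> a0; rewrite hmulA hmulxV // hmul1x. Qed.

Lemma hmulI a x y : a <> 0 -> a * x = a * y -> x = y.
Proof. by move=> a0 axy; rewrite -(hmulKx x a0) axy hmulKx. Qed.

Lemma hmulIx a x y : a <> 0 -> x * a = y * a -> x = y.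
Proof.
move=> a0 xya.
by rewrite -(hmulx1 x) -(hmulxV _ a0) hmulA xya -hmulA hmulxV ?hmulx1.
Qed.

Lemma hinv_neq0 a : a <> 0 -> a^-1 <> 0.
Proof.
move=> a0 V0; have := hmulVx _ a0; rewrite V0 hmul0x; exact: hzero_neq_hone.
Qed.

Lemma hadd_unscale a x y z :
  a <> 0 -> (a * x [+] a * y) (a * z) -> (x [+] y) z.
Proof. by move=> a0 /(hadd_scale a^-1); rewrite !hmulKx. Qed.

Lemma hmul_neq0l x y : x * y <> 0 -> x <> 0.
Proof. by move=> xy x0; apply: xy; rewrite x0 hmul0x. Qed.

End Arithmetic.

(** * Bases and circuits *)

Section Matroid.
Variables (E : finType) (N : matroid E).
Implicit Types (B D S T I A : {set E}).


(** One exchange brings a basis closer to another one; all inductions along a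
    sequence of exchanges are on this distance. *)
Lemma exchange_closer A A' x y : x \in A :\: A' -> y \in A' :\: A ->
  [/\ #|y |: A :\ x| = #|A| & #|(y |: A :\ x) :\: A'| < #|A :\: A'|].
Proof.
case/setDP=> xA xA' /setDP[yA' yA]; split.
  by rewrite cardsU1 !inE (negPf yA) andbF [RHS](cardsD1 x) xA.
apply: proper_card; apply/properP; split.
  apply/subsetP=> z; rewrite !inE => /andP[zA' /orP[/eqP zy|/andP[_ ->]]].
    by rewrite zy yA' in zA'.
  by rewrite zA'.
exists x; rewrite !inE ?xA' ?xA // eqxx orbF negb_and.
by apply/orP; right; apply/eqP=> xy; rewrite xy yA' in xA'.
Qed.

Lemma card_bases B B' : B \in bases N -> B' \in bases N -> #|B| = #|B'|.
Proof.
suff le_card A A' : A \in bases N -> A' \in bases N -> #|A| <= #|A'|.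
  by move=> bB bB'; apply/eqP; rewrite eqn_leq !le_card.
move=> bA bA'; have [n] := ubnP #|A :\: A'|.
elim: n A bA => // n IH A bA; rewrite ltnS => le_n.
have [/eqP|[x xAA']] := set_0Vmem (A :\: A').
  by rewrite setD_eq0; apply: subset_leq_card.
have [y yAA' bA1] := bases_exchange bA bA' xAA'.
have [<- lt_d] := exchange_closer xAA' yAA'.
by apply: IH => //; apply: leq_trans lt_d le_n.
Qed.

Lemma indepP I : reflect (exists2 B, B \in bases N & I \subset B) (indep N I).
Proof. exact: exists_inP. Qed.

Lemma indep_sub I A : I \subset A -> indep N A -> indep N I.
Proof.
move=> IA /indepP[B bB AB]; apply/indepP; exists B => //.
exact: subset_trans AB.
Qed.

Lemma basis_indep B : B \in bases N -> indep N B.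
Proof. by move=> bB; apply/indepP; exists B. Qed.

(** Exchanging with [B] the elements of a basis that lie outside [I :|: B]
    never touches [I]. *)
Lemma indep_extend I B : indep N I -> B \in bases N ->
  exists B', [/\ B' \in bases N, I \subset B' & B' \subset I :|: B].
Proof.
move=> /indepP[A bA IA] bB; have [n] := ubnP #|A :\: B|.
elim: n A bA IA => // n IH A bA IA; rewrite ltnS => le_n.
have [/eqP|[x xA]] := set_0Vmem (A :\: (I :|: B)).
  by rewrite setD_eq0 => AIB; exists A.
move: xA; rewrite !inE negb_or -andbA => /and3P[xI xB xA].
have xAB : x \in A :\: B by rewrite !inE xB.
have [y yBA bA1] := bases_exchange bA bB xAB.
have [_ lt_d] := exchange_closer xAB yBA.
apply: (IH _ bA1); last exact: leq_trans lt_d le_n.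
apply/subsetP=> z zI; rewrite !inE (subsetP IA) // andbT orbC.
by apply/orP; left; apply: contraNneq xI => <-.
Qed.

Lemma circuitP D : reflect
  (~~ indep N D /\ forall A, A \subset D -> ~~ indep N A -> A = D)
  (D \in circuits N).
Proof.
rewrite inE; apply: (iffP minsetP) => -[dD mD]; split=> // A ? ?;
  exact: mD.
Qed.

Lemma circuit_dep D : D \in circuits N -> ~~ indep N D.
Proof. by case/circuitP. Qed.

Lemma circuit_not_sub_basis D B :
  D \in circuits N -> B \in bases N -> ~~ (D \subset B).
Proof.
move=> cD bB; apply: contra (circuit_dep cD) => DB.
exact: indep_sub DB (basis_indep bB).
Qed.

Lemma circuitD1 D x : D \in circuits N -> x \in D -> indep N (D :\ x).
Proof.
case/circuitP=> _ mD xD; apply: contraTT xD => /(mD _ (subD1set _ _)) <-.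
by rewrite !inE eqxx.
Qed.

Lemma circuit_sub D D' :
  D \in circuits N -> D' \in circuits N -> D \subset D' -> D = D'.
Proof.
by move=> cD /circuitP[_ mD'] DD'; apply: mD' => //; apply: circuit_dep.
Qed.

Lemma circuit_neq0 D : D \in circuits N -> exists x, x \in D.
Proof.
move=> cD; have [D0|[x xD]] := set_0Vmem D; last by exists x.
have /set0Pn[B bB] := bases_neq0 N.
by have := circuit_not_sub_basis cD bB; rewrite D0 sub0set.
Qed.

Lemma dep_circuit A : ~~ indep N A -> exists2 D, D \in circuits N & D \subset A.
Proof.
move=> dA; have [D mD DA] := @minset_exists _ (fun A => ~~ indep N A) A dA.
by exists D => //; rewrite inE.
Qed.

Lemma setU1_dep B x : B \in bases N -> x \notin B -> ~~ indep N (x |: B).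
Proof.
move=> bB xB; apply/indepP=> -[B' bB' sB'].
have := subset_leq_card sB'.
by rewrite cardsU1 xB (card_bases bB bB') ltnn.
Qed.

(** If [y] is in [D], then [D :\ y] extends inside [T] to a basis; that basis
    misses [y], so by cardinality it is [T :\ y]. The right-hand side does not
    depend on [D]: this is why [T] contains only one circuit. *)
Lemma mem_circuitE T D x y : D \in circuits N -> D \subset T -> x \in T ->
  T :\ x \in bases N -> y \in T -> (y \in D) = (T :\ y \in bases N).
Proof.
move=> cD DT xT bTx yT; apply/idP/idP=> [yD|bTy]; last first.
  apply: contraR (circuit_not_sub_basis cD bTy) => yD.
  by rewrite subsetD1 DT yD.
have [B [bB DB sB]] := indep_extend (circuitD1 cD yD) bTx.
have yB : y \notin B.
  apply: contra (circuit_not_sub_basis cD bB) => yB.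
  by rewrite -(setD1K yD) subUset sub1set yB.
suff <- : B = T :\ y by [].
apply/eqP; rewrite eqEcard (card_bases bB bTx); apply/andP; split.
  rewrite subsetD1 yB andbT (subset_trans sB) // subUset subD1set andbT.
  by rewrite (subset_trans (subD1set _ _)).
by move: (cardsD1 x T) (cardsD1 y T); rewrite xT yT !add1n => -> [->].
Qed.

Lemma circuit_uniq T D D' x : D \in circuits N -> D' \in circuits N ->
  D \subset T -> D' \subset T -> x \in T -> T :\ x \in bases N -> D = D'.
Proof.
move=> cD cD' DT D'T xT bTx; apply: circuit_sub => //; apply/subsetP=> y yD.
have yT := subsetP DT _ yD.
by rewrite (mem_circuitE cD' D'T xT bTx) // -(mem_circuitE cD DT xT bTx).
Qed.

Lemma circuit_exists T x : x \in T -> T :\ x \in bases N ->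
  exists2 D, D \in circuits N & D \subset T.
Proof.
move=> xT bTx; apply: dep_circuit; rewrite -(setD1K xT).
by apply: setU1_dep => //; rewrite !inE eqxx.
Qed.

(** Every circuit [D] is fundamental: [T] is a basis containing [D :\ x], with
    [x] added, and serves all the elements of [D] at once. *)
Lemma circuit_frame D : D \in circuits N ->
  exists2 T : {set E}, D \subset T & forall y, y \in D -> T :\ y \in bases N.
Proof.
move=> cD; have [x xD] := circuit_neq0 cD.
have /indepP[B bB DB] := circuitD1 cD xD.
have xB : x \notin B.
  apply: contra (circuit_not_sub_basis cD bB) => xB.
  by rewrite -(setD1K xD) subUset sub1set xB.
have DxB : D \subset x |: B by rewrite -(setD1K xD) setUS.
exists (x |: B) => // y yD.
have bx : (x |: B) :\ x \in bases N by rewrite setU1K.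
by rewrite -(mem_circuitE cD DxB _ bx) ?setU11 ?(subsetP DxB).
Qed.

(** If the elimination failed, a basis containing [(D :|: D') :\ e] would,
    with [e] added, contain the two circuits [D] and [D']. *)
Lemma circuit_elim D D' e : D \in circuits N -> D' \in circuits N ->
  D <> D' -> e \in D -> ~~ indep N ((D :|: D') :\ e).
Proof.
move=> cD cD' neq eD; apply/indepP=> -[B bB sB]; apply: neq.
have eB : e \notin B.
  apply: contra (circuit_not_sub_basis cD bB) => eB.
  rewrite -(setD1K eD) subUset sub1set eB (subset_trans _ sB) //.
  by rewrite setSD // subsetUl.
have sU : D :|: D' \subset e |: B.
  by rewrite -(@setD1K _ e (D :|: D')) ?setUS // inE eD.
by apply: (@circuit_uniq (e |: B) _ _ e); rewrite ?setU11 ?setU1K //;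
  apply: subset_trans sU; rewrite ?subsetUl ?subsetUr.
Qed.

(** Removing from [T] an element of [D :|: D'] leaves a set that still contains
    a basis and exceeds it by one element only, hence contains a single
    circuit. So no two circuits can have their union properly inside
    [D :|: D']. *)
Lemma corank2_modular T x y D D' : x \in T -> y \in T -> x != y ->
  T :\ x :\ y \in bases N -> D \in circuits N -> D' \in circuits N ->
  D \subset T -> D' \subset T -> D <> D' ->
  modular_pair [set` circuits N]%classic D D'.
Proof.
move=> xT yT xy bT cD cD' DT D'T neq; split=> // -[A [A' [cA cA' neqA]]].
case/properP=> sAA' [e eDD' eAA']; apply: neqA.
wlog eD : D D' cD cD' DT D'T {neq} sAA' eDD' / e \in D.
  move=> wlogD; have := eDD'; rewrite inE => /orP[eD|eD].
    exact: (wlogD D D').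
  by rewrite [D :|: D']setUC in sAA' eDD'; apply: (wlogD D' D).
have [B [bB DB sB]] := indep_extend (circuitD1 cD eD) bT.
have eB : e \notin B.
  apply: contra (circuit_not_sub_basis cD bB) => eB.
  by rewrite -(setD1K eD) subUset sub1set eB.
have eT : e \in T := subsetP DT _ eD.
have sBT : B \subset T :\ e.
  rewrite subsetD1 eB andbT (subset_trans sB) // subUset.
  by rewrite !(subset_trans (subD1set _ _)) ?subD1set.
have card_Te : #|T :\ e| = #|B|.+1.
  move: (cardsD1 e T) (cardsD1 x T) (cardsD1 y (T :\ x)).
  by rewrite eT xT !inE (eq_sym y) xy yT (card_bases bB bT) !add1n => -> [->] ->.
have /card_gt0P[z] : 0 < #|(T :\ e) :\: B|.
  by rewrite cardsD (setIidPr sBT) card_Te subSnn.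
rewrite inE => /andP[zB zTe].
have bz : T :\ e :\ z \in bases N.
  suff <- : B = T :\ e :\ z by [].
  apply/eqP; rewrite eqEcard subsetD1 sBT zB /= -ltnS -card_Te.
  by rewrite (cardsD1 z (T :\ e)) zTe.
have sUT : A :|: A' \subset T :\ e.
  by rewrite subsetD1 eAA' andbT (subset_trans sAA') // subUset DT.
by apply: (circuit_uniq cA cA' _ _ zTe bz); apply: subset_trans sUT;
  rewrite ?subsetUl ?subsetUr.
Qed.

Section ModularPair.
Variables D D' : {set E}.
Hypothesis mDD' : modular_pair [set` circuits N]%classic D D'.

Lemma modular_uniq A A' z : A \in circuits N -> A' \in circuits N ->
  A \subset (D :|: D') :\ z -> A' \subset (D :|: D') :\ z ->
  z \in D :|: D' -> A = A'.
Proof.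
move=> cA cA' sA sA' zS; apply: contrapT => neq.
case: mDD' => _ _ _; apply; exists A, A'; split=> //.
have sAA' : A :|: A' \subset (D :|: D') :\ z by rewrite subUset sA.
exact: sub_proper_trans sAA' (properD1 zS).
Qed.

(** In a modular pair, deleting any element outside [D'] leaves [D'] as the
    only circuit, so deleting in addition one element of [D'] leaves an
    independent set. *)
Lemma modular_indep a b : a \in D -> a \notin D' -> b \in D' ->
  indep N ((D :|: D') :\ a :\ b).
Proof.
move=> aD aD' bD'; apply: contraT => /dep_circuit[A cA sA].
have [_ cD' _ _] := mDD'.
have AD' : A = D'.
  apply: (@modular_uniq _ _ a) => //; first exact: subset_trans sA (subD1set _ _).
    by rewrite subsetD1 subsetUr.
  by rewrite inE aD.
by move: sA; rewrite AD' subsetD1 bD' andbF.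
Qed.

(** The union of a modular pair exceeds an independent set by two elements,
    which may be chosen freely in the two differences. *)
Lemma modular_frame a b : a \in D -> a \notin D' -> b \in D' -> b \notin D ->
  exists B, [/\ B \in bases N, (D :|: D') \subset a |: (b |: B),
    a \notin B & b \notin B].
Proof.
move=> aD aD' bD' bD; have /indepP[B bB sB] := modular_indep aD aD' bD'.
have [cD cD' _ _] := mDD'.
have sU : D :|: D' \subset a |: (b |: B).
  apply/subsetP=> z zS; rewrite !inE; case: eqVneq => //= za.
  case: eqVneq => //= zb; apply: (subsetP sB).
  by rewrite in_setD1 zb in_setD1 za.
exists B; split=> //.
  apply: contra (circuit_not_sub_basis cD bB) => aB.
  apply/subsetP=> z zD; have [->//|za] := eqVneq z a.
  by apply: (subsetP sB); rewrite !inE zD za andbT; apply: contraNneq bD => <-.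
apply: contra (circuit_not_sub_basis cD' bB) => bB'.
apply/subsetP=> z zD; have [->//|zb] := eqVneq z b.
apply: (subsetP sB); rewrite !inE zD zb orbT andbT.
by apply: contraNneq aD' => <-.
Qed.

End ModularPair.

End Matroid.

(** * Juxtapositions of a set and a list of new elements *)

Section Ext.
Variable E : finType.
Implicit Types (F T : {set E}) (s : seq E).

Lemma fresh2P F a b : fresh F [:: a; b] -> [/\ a != b, a \notin F & b \notin F].
Proof. by rewrite /fresh /= !inE andbT => /and4P[]. Qed.

Lemma fresh_swap F a b : fresh F [:: a; b] -> fresh F [:: b; a].
Proof.
by move=> /fresh2P[ab aF bF]; rewrite /fresh /= inE eq_sym ab aF bF.
Qed.

Lemma fresh3P F a b c : fresh F [:: a; b; c] ->
  [/\ a != b, a != c & b != c] /\ [/\ a \notin F, b \notin F & c \notin F].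
Proof.
rewrite /fresh /= !inE !negb_or !andbT.
by move=> /andP[/andP[/andP[-> ->] ->] /and3P[-> -> ->]].
Qed.

Lemma fresh4P F a b c d : fresh F [:: a; b; c; d] ->
  [/\ a != b, a != c & a != d] /\ [/\ b != c, b != d & c != d] /\
  [/\ a \notin F, b \notin F, c \notin F & d \notin F].
Proof.
rewrite /fresh /= !inE !negb_or !andbT.
move=> /andP[/and3P[/and3P[-> -> ->] /andP[-> ->] ->] /and4P[-> -> -> ->]].
by [].
Qed.

Lemma ext_rem F s s' x : x \notin F -> x \notin s -> s' =i x :: s ->
  ext F s' :\ x = ext F s.
Proof.
move=> xF xs s's; apply/setP=> y; rewrite !inE s's inE.
by case: eqVneq => //= ->; rewrite (negPf xF) (negPf xs).
Qed.

Lemma ext_sub F s s' : {subset s <= s'} -> ext F s \subset ext F s'.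
Proof. by move=> ss'; apply/setUS/subsetP=> x; rewrite !inE; apply: ss'. Qed.

Lemma mem_ext F s x : x \in s -> x \in ext F s.
Proof. by move=> xs; rewrite !inE xs orbT. Qed.

End Ext.

(** These tactics settle the set-theoretic side conditions on juxtapositions by
    comparing lists up to order; the conditions on distinctness are looked up
    among the hypotheses. *)
Ltac solve_neq := rewrite ?inE ?negb_or; repeat (apply/andP; split);
  solve [assumption | rewrite eq_sym; assumption].
Ltac solve_seq := move=> ?; rewrite !inE; do !case: (_ == _).
Ltac solve_ext := first
  [ done
  | solve_neq
  | by rewrite mem_ext // !inE ?eqxx ?orbT
  | by apply: ext_rem; [assumption | solve_neq | solve_seq]
  | by rewrite (_ : ext _ _ :\ _ = ext _ _);
      [| apply: ext_rem; [assumption | solve_neq | solve_seq]]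
  | by apply: ext_sub; solve_seq ].

Lemma ext_frame (E : finType) (T : {set E}) (s : seq E) :
  uniq s -> {subset s <= T} ->
  fresh (T :\: [set:: s]) s /\ ext (T :\: [set:: s]) s = T.
Proof.
move=> us sT; split.
  by rewrite /fresh us; apply/allP=> x xs; rewrite !inE xs.
apply/setP=> x; rewrite !inE; case xs: (x \in s); last by rewrite orbF.
by rewrite orbT sT.
Qed.

Lemma ext_frame2 (E : finType) (T : {set E}) a b :
  a != b -> a \in T -> b \in T ->
  exists F, [/\ fresh F [:: a; b], ext F [:: a; b] = T,
    ext F [:: a] = T :\ b & ext F [:: b] = T :\ a].
Proof.
move=> ab aT bT; have [||fF eT] := @ext_frame _ T [:: a; b].
- by rewrite /= inE ab.
- by move=> x; rewrite !inE => /orP[] /eqP->.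
have [_ aF bF] := fresh2P fF; exists (T :\: [set:: [:: a; b]]).
by split=> //; rewrite -[in RHS]eT; symmetry; solve_ext.
Qed.

(** * Circuit vectors and coordinates *)

Section Compatible.
Variables (E : finType) (H : skewHyperfieldType) (N : matroid E).
Implicit Types (X Y Z : {ffun E -> H}) (C : set {ffun E -> H}).
Implicit Types (D T F B : {set E}) (q : adjacent_bases N -> H).

Lemma suppP X a : reflect (X a <> 0) (a \in supp X).
Proof. by rewrite inE; apply: asboolP. Qed.

Lemma notin_supp X a : a \notin supp X -> X a = 0.
Proof. by move=> /suppP/contrapT. Qed.

Lemma off_supp X T a : supp X \subset T -> a \notin T -> X a = 0.
Proof.
by move=> XT aT; apply/notin_supp; apply: contra aT; apply: (subsetP XT).
Qed.

Lemma supp_lscale X (r : H) : r <> 0 -> supp (lscale r X) = supp X.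
Proof.
move=> r0; apply/setP=> a; apply/suppP/suppP; rewrite ffunE.
  by move=> rX X0; apply: rX; rewrite X0 hmulx0.
exact: hmul_neq0.
Qed.

(** Membership in the vector system of the coordinates [q], freed from its
    case distinctions: bases are written [T :\ a] inside a common set [T], and
    the ratio is written without inverses. *)
Definition compatible q X := forall T a b, a != b ->
  a \in supp X -> b \in supp X -> supp X \subset T ->
  T :\ a \in bases N -> T :\ b \in bases N ->
  X b = - (X a * coord q (T :\ b) (T :\ a)).

Lemma circuits_of_coordsE q X :
  circuits_of_coords q X <-> supp X \in circuits N /\ compatible q X.
Proof.
split=> -[cX qX]; split=> //.
  move=> T a b ab aX bX XT bTa bTb.
  have [aT bT] := (subsetP XT _ aX, subsetP XT _ bX).
  have [F [fF eT eTb eTa]] := ext_frame2 ab aT bT.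
  have := qX _ a b fF aX bX; rewrite eT eTa eTb => /(_ XT bTb bTa) eX.
  by rewrite -hmulxN -eX hmulVKx //; apply/suppP.
move=> F a b /fresh2P[ab aF bF] aX bX XT bFa bFb.
have eb : ext F [:: a; b] :\ b = ext F [:: a] by solve_ext.
have ea : ext F [:: a; b] :\ a = ext F [:: b] by solve_ext.
rewrite (qX _ a b ab aX bX XT) ?ea ?eb // -hmulxN hmulKx //.
exact/suppP.
Qed.

Lemma extD_ext F a b :
  fresh F [:: a; b] -> ext F [:: a] :\: ext F [:: b] = [set a].
Proof.
move=> /fresh2P[ab aF bF]; apply/setP=> x; rewrite !inE.
case: (eqVneq x a) => [->|_]; last by case: (x \in F); rewrite ?andbF.
by rewrite (negPf aF) (negPf ab).
Qed.

Section Values.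
Variables (q : adjacent_bases N -> H) (X : {ffun E -> H}).
Hypothesis cX : supp X \in circuits N.

(** The three lemmas below take the bases as given by equations such as
    [T :\ a = B], so that [T :\ a] can be matched with a juxtaposition. *)
Lemma circuit_supp T a b B : supp X \subset T -> a \in T -> T :\ a = B ->
  B \in bases N -> b \in T -> (b \in supp X) = (T :\ b \in bases N).
Proof. by move=> XT aT <- bB bT; apply: mem_circuitE bB bT. Qed.

Lemma circuit_value_neq0 T a B : supp X \subset T -> a \in T -> T :\ a = B ->
  B \in bases N -> X a <> 0.
Proof.
by move=> XT aT eB bB; apply/suppP; rewrite (circuit_supp XT aT eB bB aT) eB.
Qed.

Lemma compatibleE T a b B B' : compatible q X -> supp X \subset T ->
  a != b -> a \in T -> b \in T -> T :\ b = B -> T :\ a = B' ->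
  B \in bases N -> B' \in bases N -> X b = - (X a * coord q B B').
Proof.
move=> qX XT ab aT bT eB eB' bB bB'; rewrite -eB -eB'.
apply: qX => //; rewrite ?eB ?eB' //.
  by apply/suppP; apply: (circuit_value_neq0 XT aT eB').
by apply/suppP; apply: (circuit_value_neq0 XT bT eB).
Qed.

End Values.

Lemma compatible_lscale q X (r : H) :
  r <> 0 -> compatible q X -> compatible q (lscale r X).
Proof.
move=> r0 qX T a b; rewrite supp_lscale // !ffunE => ab aX bX XT bTa bTb.
by rewrite (qX T a b) // hmulxN hmulA.
Qed.

(** All the entries are computed from the entry at one element [a] of the
    circuit, by the same coordinates for both vectors. *)
Lemma compatible_proportional q X Y : supp X \in circuits N ->
  supp X = supp Y -> compatible q X -> compatible q Y ->
  exists2 r : H, r <> 0 & Y = lscale r X.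
Proof.
move=> cX eXY qX qY; have [a aX] := circuit_neq0 cX.
have [T XT bT] := circuit_frame cX.
have X0 : X a <> 0 by apply/suppP.
have Y0 : Y a <> 0 by apply/suppP; rewrite -eXY.
exists (Y a * (X a)^-1); first by apply: hmul_neq0 => //; apply: hinv_neq0.
apply/ffunP=> b; rewrite ffunE; have [bX|bX] := boolP (b \in supp X); last first.
  by rewrite (notin_supp bX) hmulx0 notin_supp // -eXY.
have [->|ba] := eqVneq b a; first by rewrite -hmulA hmulVx // hmulx1.
have ab : a != b by rewrite eq_sym.
rewrite (qX T a b) // ?bT // (qY T a b) -?eXY // ?bT //.
by rewrite hmulxN -hmulA hmulKx.
Qed.

Lemma coordE q (p : adjacent_bases N) : coord q (val p).1 (val p).2 = q p.
Proof. by rewrite /coord -surjective_pairing valK. Qed.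

(** Adjacent bases exceed their intersection by one element each. *)
Lemma adjacent_bases_frame (p : adjacent_bases N) : exists T a b,
  [/\ a != b, a \in T, b \in T, (val p).1 = T :\ b & (val p).2 = T :\ a].
Proof.
case: p => -[B B'] /= /and3P[/= bB bB' /cards1P[a eBB']].
have : #|B' :\: B| == 1%N.
  rewrite -(eqn_add2l #|B' :&: B|) cardsID (card_bases bB' bB).
  by rewrite -(cardsID B' B) finset.setIC eBB' cards1.
case/cards1P=> b eB'B.
have : a \in B :\: B' by rewrite eBB' set11.
have : b \in B' :\: B by rewrite eB'B set11.
rewrite !inE => /andP[bNB bB'0] /andP[aNB' aB].
exists (B :|: B'), a, b; split; rewrite ?inE ?aB ?bB'0 ?orbT //.
- by apply: contraNneq bNB => <-.
- apply/setP=> x; move/setP/(_ x): eB'B; rewrite !inE => <-.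
  by case: (x \in B); case: (x \in B').
- apply/setP=> x; move/setP/(_ x): eBB'; rewrite !inE => <-.
  by case: (x \in B); case: (x \in B').
Qed.

(** Together with [coords_of_compatible] this identifies a map with
    [coords_of C] without a second look at the choice in the definition of the
    latter. *)
Lemma compatible_coords_uniq q q' :
  (forall D, D \in circuits N ->
     exists X, [/\ supp X = D, compatible q X & compatible q' X]) ->
  q = q'.
Proof.
move=> qq'; apply: funext => p; rewrite -(coordE q) -(coordE q').
have [T [a [b [ab aT bT eB eB']]]] := adjacent_bases_frame p.
have : adjacent N (val p) := valP p.

rewrite /adjacent eB eB' => /and3P[bTb bTa _].
have [D cD DT] := circuit_exists aT bTa.
have [X [eX qX q'X]] := qq' D cD.
have cX : supp X \in circuits N by rewrite eX.
have XT : supp X \subset T by rewrite eX.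
have := compatibleE cX qX XT ab aT bT erefl erefl bTb bTa.
rewrite (compatibleE cX q'X XT ab aT bT erefl erefl bTb bTa).
move/(congr1 (@hopp H)); rewrite !hoppK => /hmulI-> //.
exact: (circuit_value_neq0 cX XT aT erefl bTa).
Qed.

(** All the values that [coords_of] may choose from at a given pair of bases
    come from vectors with the same support, the circuit in the union of the
    pair; these are proportional by (C2). *)
Lemma coords_of_compatible C X : supports C = [set` circuits N]%classic ->
  (forall Y Z, C Y -> C Z -> supp Y \subset supp Z ->
     exists2 r : H, r <> 0 & Z = lscale r Y) ->
  C X -> compatible (coords_of (N := N) C) X.
Proof.
move=> sC C2 CX T a b ab aX bX XT bTa bTb.
have circ Y : C Y -> supp Y \in circuits N.
  by move=> CY; have : supports C (supp Y) by [exists Y]; rewrite sC.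
have [aT bT] := (subsetP XT _ aX, subsetP XT _ bX).
have [F [fF eT eTb eTa]] := ext_frame2 ab aT bT.
have adj : adjacent N (T :\ b, T :\ a).
  by rewrite /adjacent /= bTa bTb -eTa -eTb extD_ext // cards1.
pose p : adjacent_bases N := Sub _ adj.
have -> : coord (coords_of (N := N) C) (T :\ b) (T :\ a) = coords_of C p.
  exact: (coordE (coords_of C) p).
have : coords_values C p (coords_of C p).
  apply: (@xgetPex {classic H}); exists (- ((X a)^-1 * X b)), F, a, b, X.
  by rewrite /= eT eTa eTb.
case=> F' [a' [b' [Y [fF' /= [eFa eFb] CY YT ->]]]].
have ea : a' = a.
  by apply/set1_inj; rewrite -(extD_ext fF') -eFa -eFb -eTa -eTb extD_ext.
have eU G c d : ext G [:: c; d] = ext G [:: c] :|: ext G [:: d] :> {set E}.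
  by apply/setP=> x; rewrite !inE; case: (x \in G); case: (x == c).
have YT' : supp Y \subset T by rewrite -eT eU eTa eTb eFa eFb -eU.
have eb : b' = b.
  apply/set1_inj; rewrite -(extD_ext (fresh_swap fF')) -eFa -eFb -eTa -eTb.
  exact/extD_ext/fresh_swap.
rewrite {a' fF' eFa YT} ea {b'} eb in eFb *.
have [r r0 eY] : exists2 r : H, r <> 0 & X = lscale r Y.
  apply: C2 => //.
  by rewrite (circuit_uniq (circ _ CX) (circ _ CY) XT YT' aT bTa).
have Y0 : Y a <> 0.
  exact: (circuit_value_neq0 (circ _ CY) YT' aT erefl bTa).
by rewrite eY !ffunE -hmulxN hoppK -hmulA hmulVKx.
Qed.

End Compatible.

(** * From a matroid to its coordinates *)

Section OfMatroid.
Variables (E : finType) (H : skewHyperfieldType) (N : matroid E).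
Variables (q : adjacent_bases N -> H) (C : set {ffun E -> H}).
Hypotheses (mC : left_matroid C) (sC : supports C = [set` circuits N]%classic).
Hypothesis qC : forall X, C X -> compatible q X.
Implicit Types (D T F B : {set E}).

Lemma supp_circuit X : C X -> supp X \in circuits N.
Proof. by move=> CX; have : supports C (supp X) by [exists X]; rewrite sC. Qed.

Lemma circuit_vector D : D \in circuits N -> exists2 X, C X & supp X = D.
Proof. by move=> cD; have : [set` circuits N]%classic D by []; rewrite -sC. Qed.

Lemma basis_vector T a B : a \in T -> T :\ a = B -> B \in bases N ->
  exists2 X, C X & supp X \subset T.
Proof.
move=> aT eB bB; rewrite -eB in bB.
have [D cD DT] := circuit_exists aT bB.
by have [X CX eX] := circuit_vector cD; exists X; rewrite ?eX.
Qed.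

(** Inside a set of corank 2 modularity is automatic, and [Y] may be rescaled so
    that its entry at [e] cancels that of [X]. *)
Lemma corank2_elim T x y B X Y e :
  x \in T -> y \in T -> x != y -> T :\ x :\ y = B -> B \in bases N ->
  C X -> C Y -> supp X \subset T -> supp Y \subset T -> supp X <> supp Y ->
  X e <> 0 -> Y e <> 0 ->
  exists Y' Z, [/\ C Y', supp Y' = supp Y, X e = - Y' e, C Z &
    supp Z \subset T :\ e /\ forall f, (X f [+] Y' f) (Z f)].
Proof.
move=> xT yT xy eB bB CX CY XT YT neq X0 Y0; rewrite -eB in bB.
pose r := - (X e * (Y e)^-1).
have r0 : r <> 0 by apply/hopp_neq0/hmul_neq0 => //; apply: hinv_neq0.
have eY' := supp_lscale Y r0.
have CY' : C (lscale r Y) by apply: left_matroid_C1.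
have XY' : X e = - lscale r Y e.
  by rewrite ffunE hmulNx hoppK -hmulA hmulVx // hmulx1.
have mod2 : modular_pair (supports C) (supp X) (supp (lscale r Y)).
  rewrite sC; apply: (corank2_modular xT yT xy bB); rewrite ?eY' //;
    exact: supp_circuit.
have [Z [CZ Ze0 XYZ]] := left_matroid_C3 mC CX CY' mod2 XY' X0.
exists (lscale r Y), Z; split=> //; split=> //.
apply/subsetP=> f /suppP Zf; rewrite in_setD1; apply/andP; split.
  by apply/eqP=> fe; apply: Zf; rewrite fe.
apply: contraPT Zf => fT; apply; have := XYZ f.
by rewrite (off_supp XT fT) (@off_supp _ _ _ T) ?eY' // => /haddx0E.
Qed.

Lemma coords_P0 F a b : fresh F [:: a; b] ->
  ext F [:: a] \in bases N -> ext F [:: b] \in bases N ->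
  coord q (ext F [:: a]) (ext F [:: b])
    * coord q (ext F [:: b]) (ext F [:: a]) = 1.
Proof.
move=> /fresh2P[ab aF bF] bFa bFb; pose T := ext F [:: a; b].
have aT : a \in T by solve_ext.
have bT : b \in T by solve_ext.
have ea : T :\ a = ext F [:: b] by solve_ext.
have eb : T :\ b = ext F [:: a] by solve_ext.
have [X CX XT] := basis_vector aT ea bFb.
have [cX qX] := (supp_circuit CX, qC CX).
have ba : b != a by rewrite eq_sym.
have eXb := compatibleE cX qX XT ab aT bT eb ea bFa bFb.
have eXa := compatibleE cX qX XT ba bT aT ea eb bFb bFa.
have X0 := circuit_value_neq0 cX XT aT ea bFb.
apply: (hmulI X0); rewrite hmulx1 [RHS]eXa eXb.
by rewrite hmulNx hoppK hmulA.
Qed.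

Lemma coords_P1 F a b c : fresh F [:: a; b; c] ->
  ext F [:: a; b] \in bases N -> ext F [:: a; c] \in bases N ->
  ext F [:: b; c] \in bases N ->
  coord q (ext F [:: a; c]) (ext F [:: b; c])
    * coord q (ext F [:: a; b]) (ext F [:: a; c])
    * coord q (ext F [:: b; c]) (ext F [:: a; b]) = - hone.
Proof.
move=> /fresh3P[[ab ac bc] [aF bF cF]] bFab bFac bFbc.
pose T := ext F [:: a; b; c].
have [aT bT cT] : [/\ a \in T, b \in T & c \in T] by split; solve_ext.
have ea : T :\ a = ext F [:: b; c] by solve_ext.
have eb : T :\ b = ext F [:: a; c] by solve_ext.
have ec : T :\ c = ext F [:: a; b] by solve_ext.
have [X CX XT] := basis_vector aT ea bFbc.
have [cX qX] := (supp_circuit CX, qC CX).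
have ca : c != a by rewrite eq_sym.
have eXb := compatibleE cX qX XT ab aT bT eb ea bFac bFbc.
have eXc := compatibleE cX qX XT bc bT cT ec eb bFab bFac.
have eXa := compatibleE cX qX XT ca cT aT ea ec bFbc bFab.
have X0 := circuit_value_neq0 cX XT aT ea bFbc.
apply: (hmulI X0); rewrite hmulxN hmulx1 [in RHS]eXa eXc eXb.
by rewrite !hmulNx !hoppK !hmulA.
Qed.

(** Eliminating [b] between the vectors in [Fab] and [Fbc] gives the vector in
    [Fac], which inherits its entry at [a] from the first and its entry at [c]
    from the second. *)
Lemma coords_P2 F a b c : fresh F [:: a; b; c] ->
  ext F [:: a] \in bases N -> ext F [:: b] \in bases N ->
  ext F [:: c] \in bases N ->
  coord q (ext F [:: a]) (ext F [:: b])
    * coord q (ext F [:: b]) (ext F [:: c])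
    * coord q (ext F [:: c]) (ext F [:: a]) = 1.
Proof.
move=> /fresh3P[[ab ac bc] [aF bF cF]] bFa bFb bFc.
pose Tab := ext F [:: a; b]; pose Tbc := ext F [:: b; c].
pose Tac := ext F [:: a; c]; pose T := ext F [:: a; b; c].
have eab_a : Tab :\ a = ext F [:: b] by solve_ext.
have eab_b : Tab :\ b = ext F [:: a] by solve_ext.
have ebc_b : Tbc :\ b = ext F [:: c] by solve_ext.
have ebc_c : Tbc :\ c = ext F [:: b] by solve_ext.
have eac_a : Tac :\ a = ext F [:: c] by solve_ext.
have eac_c : Tac :\ c = ext F [:: a] by solve_ext.
have [aab bab] : a \in Tab /\ b \in Tab by split; solve_ext.
have [bbc cbc] : b \in Tbc /\ c \in Tbc by split; solve_ext.
have [aac cac] : a \in Tac /\ c \in Tac by split; solve_ext.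
have [bT cT] : b \in T /\ c \in T by split; solve_ext.
have eT : T :\ b :\ c = ext F [:: a].
  by rewrite (_ : T :\ b = Tac) //; solve_ext.
have TabT : Tab \subset T by solve_ext.
have TbcT : Tbc \subset T by solve_ext.
have aNbc : a \notin Tbc by rewrite !inE (negPf aF) (negPf ab) (negPf ac).
have cNab : c \notin Tab.
  by rewrite !inE (negPf cF) !(eq_sym c) (negPf bc) (negPf ac).
have [X CX XT] := basis_vector aab eab_a bFb.
have [Y CY YT] := basis_vector bbc ebc_b bFc.
have [cX cY] := (supp_circuit CX, supp_circuit CY).
have Xa0 := circuit_value_neq0 cX XT aab eab_a bFb.
have Xb0 := circuit_value_neq0 cX XT bab eab_b bFa.
have Yb0 := circuit_value_neq0 cY YT bbc ebc_b bFc.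
have neq : supp X <> supp Y.
  move=> eXY; have /suppP := Xa0; rewrite eXY => /(subsetP YT).
  by rewrite (negPf aNbc).
have [Y' [Z [CY' eY' XbY' CZ [ZT XYZ]]]] := corank2_elim bT cT bc eT bFa CX CY
  (subset_trans XT TabT) (subset_trans YT TbcT) neq Xb0 Yb0.
have Y'T : supp Y' \subset Tbc by rewrite eY'.
have {}ZT : supp Z \subset Tac.
  by rewrite (_ : Tac = T :\ b) //; symmetry; solve_ext.
have Za : Z a = X a by apply/haddx0E; rewrite -(off_supp Y'T aNbc).
have Zc : Z c = Y' c by apply/hadd0xE; rewrite -(off_supp XT cNab).
have ca : c != a by rewrite eq_sym.
have [cY' cZ] := (supp_circuit CY', supp_circuit CZ).
have eXb := compatibleE cX (qC CX) XT ab aab bab eab_b eab_a bFa bFb.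
have eYc := compatibleE cY' (qC CY') Y'T bc bbc cbc ebc_c ebc_b bFb bFc.
have eZa := compatibleE cZ (qC CZ) ZT ca cac aac eac_a eac_c bFc bFa.
apply: (hmulI Xa0); rewrite hmulx1 -[RHS]Za eZa Zc eYc !hmulA.
by rewrite -[in LHS](hoppK (X a * _)) -eXb XbY' !hmulNx.
Qed.

(** The left-hand side is a ratio in the vector [X] of [Fabc]. If [X] vanishes
    at [c], which is the case when [Fab] is not a basis, then it lives in [Fabd]
    too. Otherwise [Fcd] is not a basis, so that the circuit in [Facd] avoids
    [a]; eliminating [c] from [X] with the help of that circuit moves [X] into
    [Fabd] and leaves the entries at [a] and [b] alone. *)
Lemma coords_P3 F a b c d : fresh F [:: a; b; c; d] ->
  ext F [:: a; c] \in bases N -> ext F [:: a; d] \in bases N ->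
  ext F [:: b; c] \in bases N -> ext F [:: b; d] \in bases N ->
  ext F [:: a; b] \notin bases N \/ ext F [:: c; d] \notin bases N ->
  coord q (ext F [:: a; c]) (ext F [:: b; c])
    = coord q (ext F [:: a; d]) (ext F [:: b; d]).
Proof.
move=> /fresh4P[[ab ac ad] [[bc bd cd] [aF bF cF dF]]] bac bad bbc bbd bases_or.
pose Td := ext F [:: a; b; c]; pose Tc := ext F [:: a; b; d].
pose Tb := ext F [:: a; c; d]; pose T := ext F [:: a; b; c; d].
have ed_a : Td :\ a = ext F [:: b; c] by solve_ext.
have ed_b : Td :\ b = ext F [:: a; c] by solve_ext.
have ed_c : Td :\ c = ext F [:: a; b] by solve_ext.
have ec_a : Tc :\ a = ext F [:: b; d] by solve_ext.
have ec_b : Tc :\ b = ext F [:: a; d] by solve_ext.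
have eb_a : Tb :\ a = ext F [:: c; d] by solve_ext.
have eb_c : Tb :\ c = ext F [:: a; d] by solve_ext.
have [aTd bTd cTd] : [/\ a \in Td, b \in Td & c \in Td] by split; solve_ext.
have [aTc bTc dTc] : [/\ a \in Tc, b \in Tc & d \in Tc] by split; solve_ext.
have [aTb cTb dTb] : [/\ a \in Tb, c \in Tb & d \in Tb] by split; solve_ext.
have bNTb : b \notin Tb.
  by rewrite !inE (negPf bF) (eq_sym b a) (negPf ab) (negPf bc) (negPf bd).
have [X CX XT] := basis_vector aTd ed_a bbc.
have cX := supp_circuit CX.
have Xa0 := circuit_value_neq0 cX XT aTd ed_a bbc.
have eXb := compatibleE cX (qC CX) XT ab aTd bTd ed_b ed_a bac bbc.
(* It suffices to find a circuit vector inside [Tc] that agrees with [X] at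
   [a] and [b]. *)
suff [W [CW WT Wa Wb]] : exists W,
    [/\ C W, supp W \subset Tc, W a = X a & W b = X b].
  have cW := supp_circuit CW.
  have eWb := compatibleE cW (qC CW) WT ab aTc bTc ec_b ec_a bad bbd.
  apply: (hmulI Xa0); apply: (can_inj (@hoppK H)).
  by rewrite -eXb -Wb eWb Wa.
have [cX'|cX'] := boolP (c \in supp X); last first.
  have XF : supp X \subset ext F [:: a; b] by rewrite -ed_c subsetD1 XT.
  by exists X; split=> //; apply: (subset_trans XF); solve_ext.
have ncd : ext F [:: c; d] \notin bases N.
  case: bases_or => //; rewrite -ed_c.
  by rewrite -(circuit_supp cX XT aTd ed_a bbc cTd) cX'.
have [Z CZ ZT] := basis_vector cTb eb_c bad.
have cZ := supp_circuit CZ.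
have aZ : a \notin supp Z by rewrite (circuit_supp cZ ZT cTb eb_c bad aTb) eb_a.
have bZ : b \notin supp Z by apply: contra bNTb; apply: (subsetP ZT).
have Zc0 := circuit_value_neq0 cZ ZT cTb eb_c bad.
have neq : supp X <> supp Z.
  by move=> eXZ; have /suppP := Xa0; rewrite eXZ (negPf aZ).
have [bT dT] : b \in T /\ d \in T by split; solve_ext.
have eT : T :\ b :\ d = ext F [:: a; c].
  by rewrite (_ : T :\ b = Tb) //; solve_ext.
have TdT : Td \subset T by solve_ext.
have TbT : Tb \subset T by solve_ext.
have Xc0 : X c <> 0 by apply/suppP.
have [Z' [W [CZ' eZ' _ CW [WT XZW]]]] := corank2_elim bT dT bd eT bac CX CZ
  (subset_trans XT TdT) (subset_trans ZT TbT) neq Xc0 Zc0.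
exists W; split=> //.
- by rewrite (_ : Tc = T :\ c) //; symmetry; solve_ext.
- by apply/haddx0E; rewrite -(@notin_supp _ _ Z' a) ?eZ'.
- by apply/haddx0E; rewrite -(@notin_supp _ _ Z' b) ?eZ'.
Qed.

(** Eliminating [c] between the vectors in [Facd] and [Fbcd] gives the vector
    [Z] in [Fabd], which inherits its entries at [a] and [b]. The two products
    of coordinates are then the entries at [d] of the two given vectors,
    divided on the left by [Z d]. *)
Lemma coords_P4 F a b c d : fresh F [:: a; b; c; d] ->
  ext F [:: a; c] \in bases N -> ext F [:: a; d] \in bases N ->
  ext F [:: b; c] \in bases N -> ext F [:: b; d] \in bases N ->
  ext F [:: a; b] \in bases N -> ext F [:: c; d] \in bases N ->
  (coord q (ext F [:: b; d]) (ext F [:: a; b])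
     * coord q (ext F [:: a; c]) (ext F [:: c; d])
   [+] coord q (ext F [:: a; d]) (ext F [:: a; b])
     * coord q (ext F [:: b; c]) (ext F [:: c; d])) 1.
Proof.
move=> /fresh4P[[ab ac ad] [[bc bd cd] [aF bF cF dF]]] bac bad bbc bbd bab bcd.
pose Ta := ext F [:: b; c; d]; pose Tc := ext F [:: a; b; d].
pose Tb := ext F [:: a; c; d]; pose T := ext F [:: a; b; c; d].
have ea_b : Ta :\ b = ext F [:: c; d] by solve_ext.
have ea_c : Ta :\ c = ext F [:: b; d] by solve_ext.
have ea_d : Ta :\ d = ext F [:: b; c] by solve_ext.
have eb_a : Tb :\ a = ext F [:: c; d] by solve_ext.
have eb_c : Tb :\ c = ext F [:: a; d] by solve_ext.
have eb_d : Tb :\ d = ext F [:: a; c] by solve_ext.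
have ec_a : Tc :\ a = ext F [:: b; d] by solve_ext.
have ec_b : Tc :\ b = ext F [:: a; d] by solve_ext.
have ec_d : Tc :\ d = ext F [:: a; b] by solve_ext.
have [bTa cTa dTa] : [/\ b \in Ta, c \in Ta & d \in Ta] by split; solve_ext.
have [aTb cTb dTb] : [/\ a \in Tb, c \in Tb & d \in Tb] by split; solve_ext.
have [aTc bTc dTc] : [/\ a \in Tc, b \in Tc & d \in Tc] by split; solve_ext.
have aNTa : a \notin Ta.
  by rewrite !inE (negPf aF) (negPf ab) (negPf ac) (negPf ad).
have bNTb : b \notin Tb.
  by rewrite !inE (negPf bF) (eq_sym b a) (negPf ab) (negPf bc) (negPf bd).
have [Y CY YT] := basis_vector aTb eb_a bcd.
have [W CW WT] := basis_vector bTa ea_b bcd.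
have [cY cW] := (supp_circuit CY, supp_circuit CW).
have Ya0 := circuit_value_neq0 cY YT aTb eb_a bcd.
have Yc0 := circuit_value_neq0 cY YT cTb eb_c bad.
have Wc0 := circuit_value_neq0 cW WT cTa ea_c bbd.
have neq : supp Y <> supp W.
  move=> eYW; have /suppP := Ya0; rewrite eYW => /(subsetP WT).
  by rewrite (negPf aNTa).
have [bT dT] : b \in T /\ d \in T by split; solve_ext.
have eT : T :\ b :\ d = ext F [:: a; c].
  by rewrite (_ : T :\ b = Tb) //; solve_ext.
have TaT : Ta \subset T by solve_ext.
have TbT : Tb \subset T by solve_ext.
have [W' [Z [CW' eW' _ CZ [ZT YWZ]]]] := corank2_elim bT dT bd eT bac CY CW
  (subset_trans YT TbT) (subset_trans WT TaT) neq Yc0 Wc0.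
have W'T : supp W' \subset Ta by rewrite eW'.
have {}ZT : supp Z \subset Tc.
  by rewrite (_ : Tc = T :\ c) //; symmetry; solve_ext.
have Za : Z a = Y a by apply/haddx0E; rewrite -(off_supp W'T aNTa).
have Zb : Z b = W' b by apply/hadd0xE; rewrite -(off_supp YT bNTb).
have [cW' cZ] := (supp_circuit CW', supp_circuit CZ).
have [da db] : d != a /\ d != b by rewrite !(eq_sym d).
have eZa := compatibleE cZ (qC CZ) ZT da dTc aTc ec_a ec_d bbd bab.
have eZb := compatibleE cZ (qC CZ) ZT db dTc bTc ec_b ec_d bad bab.
have eYd := compatibleE cY (qC CY) YT ad aTb dTb eb_d eb_a bac bcd.
have eWd := compatibleE cW' (qC CW') W'T bd bTa dTa ea_d ea_b bbc bcd.
have Zd0 := circuit_value_neq0 cZ ZT dTc ec_d bab.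
have := YWZ d; rewrite eYd -Za eZa eWd -Zb eZb.
rewrite !hmulNx !hoppK -!hmulA -{3}(hmulx1 (Z d)).
exact: hadd_unscale.
Qed.

Lemma quasi_Plucker_of_matroid : quasi_Plucker q.
Proof.
split; [exact: coords_P0 | exact: coords_P1 | exact: coords_P2 |
  exact: coords_P3 | exact: coords_P4].
Qed.

Lemma circuits_of_matroid : C = circuits_of_coords q.
Proof.
apply/predeqP=> X; split=> [CX|/circuits_of_coordsE[cX qX]].
  by apply/circuits_of_coordsE; split; [apply: supp_circuit | apply: qC].
have [Y CY eY] := circuit_vector cX.
have [r r0 ->] := compatible_proportional (supp_circuit CY) eY (qC CY) qX.
exact: left_matroid_C1.
Qed.

End OfMatroid.


(** * From coordinates to a matroid *)

Section OfCoords.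
Variables (E : finType) (H : skewHyperfieldType) (N : matroid E).
Variable q : adjacent_bases N -> H.
Hypothesis qP : quasi_Plucker q.
Implicit Types (D T F B : {set E}) (X Y Z : {ffun E -> H}).

Lemma coord_inv T a b : a != b -> a \in T -> b \in T ->
  T :\ a \in bases N -> T :\ b \in bases N ->
  coord q (T :\ b) (T :\ a) * coord q (T :\ a) (T :\ b) = 1.
Proof.
move=> ab aT bT bTa bTb; have [F [fF _ ea eb]] := ext_frame2 ab aT bT.
by rewrite -ea -eb; apply: quasi_Plucker_P0; rewrite ?ea ?eb.
Qed.

Lemma coord_neq0 T a b : a != b -> a \in T -> b \in T ->
  T :\ a \in bases N -> T :\ b \in bases N -> coord q (T :\ b) (T :\ a) <> 0.
Proof.
move=> ab aT bT bTa bTb; apply: (@hmul_neq0l _ _ (coord q (T :\ a) (T :\ b))).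
by rewrite coord_inv //; apply/nesym/hzero_neq_hone.
Qed.

(** (P1), solved for one of its three coordinates by means of (P0). *)
Lemma coord_comp T a b c : a != b -> a != c -> b != c ->
  a \in T -> b \in T -> c \in T ->
  T :\ a \in bases N -> T :\ b \in bases N -> T :\ c \in bases N ->
  coord q (T :\ c) (T :\ a)
    = - (coord q (T :\ b) (T :\ a) * coord q (T :\ c) (T :\ b)).
Proof.
move=> ab ac bc aT bT cT bTa bTb bTc.
have [||fF eT] := @ext_frame _ T [:: a; b; c].
- by rewrite /= !inE negb_or ab ac bc.
- by move=> x; rewrite !inE => /or3P[] /eqP->.
have [_ [aF bF cF]] := fresh3P fF; set F := T :\: _ in fF eT aF bF cF.
have ea : ext F [:: b; c] = T :\ a by rewrite -eT; symmetry; solve_ext.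
have eb : ext F [:: a; c] = T :\ b by rewrite -eT; symmetry; solve_ext.
have ec : ext F [:: a; b] = T :\ c by rewrite -eT; symmetry; solve_ext.
have := quasi_Plucker_P1 qP fF; rewrite ea eb ec => /(_ bTc bTb bTa) P1.
have ca : c != a by rewrite eq_sym.
apply: (hmulIx (coord_neq0 ca cT aT bTc bTa)).
by rewrite coord_inv // hmulNx P1 hoppK.
Qed.

(** The bases [T :\ b] and [T' :\ b] are linked by exchanges that keep
    [D :\ b]. An exchange of [x] for [y] turns [T] into [T1], and [T :\ x] still
    contains [D], hence is not a basis; so (P3) applies to [a], [b], [x], [y]. *)
Lemma coord_indep D T T' a b : D \in circuits N -> a \in D -> b \in D ->
  a != b -> D \subset T -> D \subset T' ->
  T :\ b \in bases N -> T' :\ b \in bases N ->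
  coord q (T :\ b) (T :\ a) = coord q (T' :\ b) (T' :\ a).
Proof.
move=> cD aD bD ab DT DT' bTb bT'b.
have [n] := ubnP #|(T :\ b) :\: (T' :\ b)|.
elim: n T DT bTb => // n IH T DT bTb; rewrite ltnS => le_n.
have [aT bT] := (subsetP DT _ aD, subsetP DT _ bD).
have bT' := subsetP DT' _ bD.
have [/eqP|[x xd]] := set_0Vmem ((T :\ b) :\: (T' :\ b)).
  rewrite setD_eq0 => sTT'; have eTT' : T :\ b = T' :\ b.
    by apply/eqP; rewrite eqEcard sTT' (card_bases bTb bT'b) leqnn.
  by rewrite -(setD1K bT) eTT' setD1K.
have [y yd bT1] := bases_exchange bTb bT'b xd.
have [_ lt_d] := exchange_closer xd yd.
have [xb xT xT'] : [/\ x != b, x \in T & x \notin T'].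
  by move: xd; rewrite !inE; case: (x == b); case: (x \in T); case: (x \in T').
have [yb yT' yT] : [/\ y != b, y \in T' & y \notin T].
  by move: yd; rewrite !inE; case: (y == b); case: (y \in T); case: (y \in T').
have xD : x \notin D by apply: contra xT'; apply: (subsetP DT').
have ax : a != x by apply: contraNneq xD => <-.
have [||fF eT] := @ext_frame _ T [:: a; b; x].
- by rewrite /= !inE negb_or ab ax eq_sym xb.
- by move=> z; rewrite !inE => /or3P[] /eqP->.
have [_ [aF bF xF]] := fresh3P fF; set F := T :\: _ in fF eT aF bF xF.
have yF : y \notin F by rewrite inE (negPf yT) andbF.
have [ay xy] : a != y /\ x != y by split; apply: contraNneq yT => <-.
have bx : b != x by rewrite eq_sym.
have by' : b != y by rewrite eq_sym.
pose T1 := ext F [:: a; b; y].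
have eTa : T :\ a = ext F [:: b; x] by rewrite -eT; solve_ext.
have eTb : T :\ b = ext F [:: a; x] by rewrite -eT; solve_ext.
have eTx : T :\ x = ext F [:: a; b] by rewrite -eT; solve_ext.
have eT1a : T1 :\ a = ext F [:: b; y] by solve_ext.
have eT1b : T1 :\ b = ext F [:: a; y] by solve_ext.
have eT1 : y |: T :\ b :\ x = T1 :\ b.
  rewrite eT1b eTb (_ : _ :\ x = ext F [:: a]); last by solve_ext.
  by apply/setP=> z; rewrite !inE; case: (z == y); rewrite ?orbT ?orbF.
have DTx : D \subset T :\ x by rewrite subsetD1 DT.
have DT1 : D \subset T1 by apply: (subset_trans DTx); rewrite eTx; solve_ext.
rewrite eT1 in bT1 lt_d.
rewrite -(IH T1 DT1 bT1 (leq_trans lt_d le_n)).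
have bTa : T :\ a \in bases N by rewrite -(mem_circuitE cD DT bT bTb aT).
have aT1 : a \in T1 := subsetP DT1 _ aD.
have bT1' : b \in T1 := subsetP DT1 _ bD.
have bT1a : T1 :\ a \in bases N by rewrite -(mem_circuitE cD DT1 bT1' bT1 aT1).
have nab : ext F [:: a; b] \notin bases N.
  rewrite -eTx; apply: contra (circuit_dep cD) => /basis_indep.
  exact: indep_sub.
have fF' : fresh F [:: a; b; x; y].
  rewrite /fresh /= !in_cons !in_nil !orbF !negb_or.
  by rewrite ab ax ay bx by' xy aF bF xF yF.
have := quasi_Plucker_P3 qP fF'; rewrite -eTa -eTb -eT1a -eT1b.
by apply=> //; left.
Qed.

(** The vector is normalized at one element of the circuit, where the other
    entries are prescribed by coordinates; (P1) makes the remaining ratios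
    right. *)
Lemma vector_of_circuit D : D \in circuits N ->
  exists X, supp X = D /\ compatible q X.
Proof.
move=> cD; have [a aD] := circuit_neq0 cD; have [T DT bT] := circuit_frame cD.
pose X := [ffun b => if b == a then 1
  else if b \in D then - coord q (T :\ b) (T :\ a) else (0 : H)].
have T_ b : b \in D -> b \in T by apply: (subsetP DT).
have eX : supp X = D.
  apply/setP=> b; apply/suppP/idP; rewrite ffunE.
    by case: eqVneq => [->//|_]; case: (b \in D).
  move=> bD; case: eqVneq => [_|ba]; first exact/nesym/hzero_neq_hone.
  rewrite bD; apply/hopp_neq0/coord_neq0; rewrite ?bT ?T_ //.
  by rewrite eq_sym.
exists X; split=> // T' b c bc; rewrite eX => bD cD' DT' bT'b bT'c.
rewrite (coord_indep cD bD cD' bc DT' DT bT'c (bT _ cD')) !ffunE bD cD'.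
have [eba|ba] := eqVneq b a.
  by rewrite -eba eq_sym (negPf bc) hmul1x.
have ab : a != b by rewrite eq_sym.
have [->|ca] := eqVneq c a.
  by rewrite hmulNx hoppK coord_inv ?bT ?T_.
have ac : a != c by rewrite eq_sym.
by rewrite (coord_comp ab ac bc) ?bT ?T_ // hmulNx.
Qed.

Section Elimination.
Variables X Y Z : {ffun E -> H}.
Hypotheses (cX : supp X \in circuits N) (cY : supp Y \in circuits N).
Hypotheses (cZ : supp Z \in circuits N).
Hypotheses (qX : compatible q X) (qY : compatible q Y) (qZ : compatible q Z).
Hypothesis mXY : modular_pair [set` circuits N]%classic (supp X) (supp Y).
Let S := (supp X :|: supp Y).

Let suppXS x : x \in supp X -> x \in S.
Proof. by move=> xX; apply/setUP; left. Qed.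

Let suppYS x : x \in supp Y -> x \in S.
Proof. by move=> xY; apply/setUP; right. Qed.

(** The supports of [X], [Y] and [Z] share [a], [b] and [e] pairwise. With
    [F := B :\ e] they lie in [Fae], [Fbe] and [Fab], and the three ratios are
    the coordinates in (P2). *)
Lemma triangle a b e : a \in supp X -> a \notin supp Y ->
  b \in supp Y -> b \notin supp X -> e \in supp X -> e \in supp Y ->
  supp Z \subset S :\ e ->
  exists p r s : H, [/\ p * r * s = 1, X e = - (X a * p), Y b = - (Y e * r)
    & Z a = - (Z b * s)].
Proof.
move=> aX aY bY bX eX eY ZS.
have [B [bB SB aB bB']] := modular_frame mXY aX aY bY bX.
have ae : a != e by apply: contraNneq aY => ->.
have be : b != e by apply: contraNneq bX => ->.
have ab : a != b by apply: contraNneq aY => ->.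
have ea : e != a by rewrite eq_sym.
have eb : e != b by rewrite eq_sym.
have ba : b != a by rewrite eq_sym.
have eB : e \in B.
  by have := subsetP SB e (suppXS eX); rewrite !inE (negPf ea) (negPf eb).
pose F := B :\ e; have eF : e \notin F by rewrite !inE eqxx.
have [aF bF] : a \notin F /\ b \notin F.
  by rewrite !inE (negPf aB) (negPf bB') !andbF.
have memS x : x \in S -> [|| x == a, x == b, x == e | x \in F].
  by move/(subsetP SB); rewrite !inE; case: (x == e); rewrite ?orbT.
pose Ta := ext F [:: b; e]; pose Tb := ext F [:: a; e].
pose Te := ext F [:: a; b].
have XT : supp X \subset Tb.
  apply/subsetP=> x xX; have := memS x (suppXS xX).
  rewrite !inE; case: (eqVneq x b) => [xb|_]; first by rewrite -xb xX in bX.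
  by case: (x \in B); case: (x == a); case: (x == e).
have YT : supp Y \subset Ta.
  apply/subsetP=> x xY; have := memS x (suppYS xY).
  rewrite !inE; case: (eqVneq x a) => [xa|_]; first by rewrite -xa xY in aY.
  by case: (x \in B); case: (x == b); case: (x == e).
have ZT : supp Z \subset Te.
  apply/subsetP=> x /(subsetP ZS); rewrite in_setD1 => /andP[xe /memS].
  by rewrite !inE (negPf xe); case: (x \in B); case: (x == b); case: (x == a).
have Tab : Ta :\ b = ext F [:: e] by solve_ext.
have Tae : Ta :\ e = ext F [:: b] by solve_ext.
have Tba : Tb :\ a = ext F [:: e] by solve_ext.
have Tbe : Tb :\ e = ext F [:: a] by solve_ext.
have Tea : Te :\ a = ext F [:: b] by solve_ext.
have Teb : Te :\ b = ext F [:: a] by solve_ext.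
have [bTa eTa] : b \in Ta /\ e \in Ta by split; solve_ext.
have [aTb eTb] : a \in Tb /\ e \in Tb by split; solve_ext.
have [aTe bTe] : a \in Te /\ b \in Te by split; solve_ext.
have bFe : ext F [:: e] \in bases N.
  rewrite (_ : ext F _ = B) //; apply/setP=> x; rewrite !inE.
  by case: eqVneq => [->|_]; rewrite ?eB ?orbF.
have bFa : ext F [:: a] \in bases N.
  by rewrite -Tbe -(circuit_supp cX XT aTb Tba bFe eTb).
have bFb : ext F [:: b] \in bases N.
  by rewrite -Tae -(circuit_supp cY YT bTa Tab bFe eTa).
exists (coord q (ext F [:: a]) (ext F [:: e])).
exists (coord q (ext F [:: e]) (ext F [:: b])).
exists (coord q (ext F [:: b]) (ext F [:: a])).
split.
- apply: quasi_Plucker_P2 => //.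
  by rewrite /fresh /= !in_cons !in_nil !orbF negb_or ae ab eb aF bF eF.
- exact: (compatibleE cX qX XT ae).
- exact: (compatibleE cY qY YT eb).
- exact: (compatibleE cZ qZ ZT ba).
Qed.

(** With [F := B :\ e :\ f] the three supports lie in [Faef], [Fbef] and [Fabf],
    and (P4) for [a], [b], [e], [f] is the claim, divided on the left by
    [Z f]. *)
Lemma tetrahedron a b e f : a \in supp X -> a \notin supp Y ->
  b \in supp Y -> b \notin supp X -> e \in supp X -> e \in supp Y ->
  supp Z \subset S :\ e ->
  f \in supp X -> f \in supp Y -> f \in supp Z ->
  Z a = X a -> Z b = Y b -> (X f [+] Y f) (Z f).
Proof.
move=> aX aY bY bX eX eY ZS fX fY fZ Za Zb.
have [B [bB SB aB bB']] := modular_frame mXY aX aY bY bX.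
have ab : a != b by apply: contraNneq aY => ->.
have ae : a != e by apply: contraNneq aY => ->.
have af : a != f by apply: contraNneq aY => ->.
have be : b != e by apply: contraNneq bX => ->.
have bf : b != f by apply: contraNneq bX => ->.
have ef : e != f.
  apply: contraTneq fZ => <-; apply: contraNN (negbT (setD11 e S)).
  exact: (subsetP ZS).
have [fa fb] : f != a /\ f != b by rewrite !(eq_sym f).
have memB x : x \in S -> x != a -> x != b -> x \in B.
  by move=> /(subsetP SB); rewrite !inE => /or3P[/eqP->|/eqP->|//]; rewrite eqxx.
have eB : e \in B by apply: memB (suppXS eX) _ _; rewrite eq_sym.
have fB : f \in B by apply: memB (suppXS fX) fa fb.
pose F := B :\ e :\ f.
have [eF fF] : e \notin F /\ f \notin F by rewrite !inE !eqxx ?andbF.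
have [aF bF] : a \notin F /\ b \notin F.
  by rewrite !inE (negPf aB) (negPf bB') !andbF.
have memS x : x \in S -> [|| x == a, x == b, x == e, x == f | x \in F].
  move=> xS; rewrite !inE; case: eqVneq => //= xa; case: eqVneq => //= xb.
  by rewrite (memB x) // andbT; case: (x == e); case: (x == f).
pose Ta := ext F [:: b; e; f]; pose Tb := ext F [:: a; e; f].
pose Te := ext F [:: a; b; f].
have XT : supp X \subset Tb.
  apply/subsetP=> x xX; have := memS x (suppXS xX).
  rewrite !inE; case: (eqVneq x b) => [xb|_]; first by rewrite -xb xX in bX.
  by case: (x \in B); case: (x == a); case: (x == e); case: (x == f).
have YT : supp Y \subset Ta.
  apply/subsetP=> x xY; have := memS x (suppYS xY).
  rewrite !inE; case: (eqVneq x a) => [xa|_]; first by rewrite -xa xY in aY.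
  by case: (x \in B); case: (x == b); case: (x == e); case: (x == f).
have ZT : supp Z \subset Te.
  apply/subsetP=> x /(subsetP ZS); rewrite in_setD1 => /andP[xe /memS].
  rewrite !inE (negPf xe).
  by case: (x \in B); case: (x == b); case: (x == a); case: (x == f).
have Tab : Ta :\ b = ext F [:: e; f] by solve_ext.
have Tae : Ta :\ e = ext F [:: b; f] by solve_ext.
have Taf : Ta :\ f = ext F [:: b; e] by solve_ext.
have Tba : Tb :\ a = ext F [:: e; f] by solve_ext.
have Tbe : Tb :\ e = ext F [:: a; f] by solve_ext.
have Tbf : Tb :\ f = ext F [:: a; e] by solve_ext.
have Tea : Te :\ a = ext F [:: b; f] by solve_ext.
have Teb : Te :\ b = ext F [:: a; f] by solve_ext.
have Tef : Te :\ f = ext F [:: a; b] by solve_ext.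
have [bTa eTa fTa] : [/\ b \in Ta, e \in Ta & f \in Ta] by split; solve_ext.
have [aTb eTb fTb] : [/\ a \in Tb, e \in Tb & f \in Tb] by split; solve_ext.
have [aTe bTe fTe] : [/\ a \in Te, b \in Te & f \in Te] by split; solve_ext.
have bef : ext F [:: e; f] \in bases N.
  rewrite (_ : ext F _ = B) //; apply/setP=> x; rewrite !inE.
  by case: eqVneq => [->|_]; case: eqVneq => [->|_]; rewrite ?eB ?fB ?orbF.
have baf : ext F [:: a; f] \in bases N.
  by rewrite -Tbe -(circuit_supp cX XT aTb Tba bef eTb).
have bae : ext F [:: a; e] \in bases N.
  by rewrite -Tbf -(circuit_supp cX XT aTb Tba bef fTb).
have bbf : ext F [:: b; f] \in bases N.
  by rewrite -Tae -(circuit_supp cY YT bTa Tab bef eTa).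
have bbe : ext F [:: b; e] \in bases N.
  by rewrite -Taf -(circuit_supp cY YT bTa Tab bef fTa).
have bab : ext F [:: a; b] \in bases N.
  by rewrite -Tef -(circuit_supp cZ ZT aTe Tea bbf fTe).
have fr : fresh F [:: a; b; e; f].
  rewrite /fresh /= !in_cons !in_nil !orbF !negb_or.
  by rewrite ab ae af be bf ef aF bF eF fF.
have eZa := compatibleE cZ qZ ZT fa fTe aTe Tea Tef bbf bab.
have eZb := compatibleE cZ qZ ZT fb fTe bTe Teb Tef baf bab.
have eXf := compatibleE cX qX XT af aTb fTb Tbf Tba bae bef.
have eYf := compatibleE cY qY YT bf bTa fTa Taf Tab bbe bef.
rewrite eXf eYf -Za -Zb eZa eZb !hmulNx !hoppK -!hmulA -[Z f in X in _ X]hmulx1.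
apply: hadd_scale; exact: quasi_Plucker_P4.
Qed.

End Elimination.

Lemma supports_of_coords :
  supports (circuits_of_coords q) = [set` circuits N]%classic.
Proof.
apply/predeqP=> D; split=> [[X [cX _] <-] //|cD].
have [X [eX qX]] := vector_of_circuit cD.
by exists X => //; apply/circuits_of_coordsE; rewrite eX.
Qed.

(** Let [Z] be the vector of the circuit that avoids [e]. It agrees with [Y]
    outside the support of [X] ([onY]) and with [X] outside the support of [Y]
    ([onX]), and it vanishes only where [X] and [Y] cancel; each of these
    follows from an instance of [triangle]. The elements common to the three
    supports are left to [tetrahedron]. *)
Lemma coords_elim X Y e : circuits_of_coords q X -> circuits_of_coords q Y ->
  modular_pair [set` circuits N]%classic (supp X) (supp Y) ->
  X e = - Y e -> X e <> 0 ->
  exists Z, [/\ circuits_of_coords q Z, Z e = 0 &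
    forall f, (X f [+] Y f) (Z f)].
Proof.
move=> /circuits_of_coordsE[cX qX] /circuits_of_coordsE[cY qY] mXY XYe Xe0.
have neq : supp X <> supp Y by case: mXY.
have eX : e \in supp X by apply/suppP.
have eY : e \in supp Y by apply/suppP=> Y0; apply: Xe0; rewrite XYe Y0 hopp0.
have [a aX aY] : exists2 a, a \in supp X & a \notin supp Y.
  by apply/subsetPn; apply/negP=> /(circuit_sub cX cY).
have [b bY bX] : exists2 b, b \in supp Y & b \notin supp X.
  by apply/subsetPn; apply/negP=> /(circuit_sub cY cX)/esym.
have [D cD DS] := dep_circuit (circuit_elim cX cY neq eX).
have [Z0 [eZ0 qZ0]] := vector_of_circuit cD.
have Z0a : Z0 a <> 0.
  apply/suppP; rewrite eZ0; apply: contraT => aD.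
  have DY : D = supp Y.
    apply: (modular_uniq mXY (z := a)) => //.
    - by rewrite subsetD1 aD andbT (subset_trans DS) ?subD1set.
    - by rewrite subsetD1 aY subsetUr.
    - by apply/setUP; left.
  by move: DS; rewrite subsetD1 DY eY andbF.
(* The scale of [Z] is fixed by its entry at [a], where only [X] contributes. *)
pose r := X a * (Z0 a)^-1.
have r0 : r <> 0 by apply: hmul_neq0; [apply/suppP | apply: hinv_neq0].
pose Z := lscale r Z0.
have Za : Z a = X a by rewrite ffunE -hmulA hmulVx // hmulx1.
have eZ : supp Z = D by rewrite supp_lscale.
have qZ : compatible q Z by apply: compatible_lscale.
have cZ : supp Z \in circuits N by rewrite eZ.
have ZS : supp Z \subset (supp X :|: supp Y) :\ e by rewrite eZ.
(* A product equal to 1 stays so under cyclic rotation, also without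
   commutativity. *)
have cyc u v w : u * v * w = 1 -> w * u * v = 1 :> H.
  move=> uvw; have w0 : w <> 0.
    by move=> w0; move: uvw; rewrite w0 hmulx0; apply: hzero_neq_hone.
  by apply: (hmulIx w0); rewrite -!hmulA (hmulA u) uvw hmulx1 hmul1x.
have onY f : f \in supp Y -> f \notin supp X -> Z f = Y f.
  move=> fY fX.
  have [u [v [w [uvw eXe eYf eZa]]]] :=
    triangle cX cY cZ qX qY qZ mXY aX aY fY fX eX eY ZS.
  have eYe : Y e = X a * u by rewrite -(hoppK (Y e)) -XYe eXe hoppK.
  by rewrite eYf eYe -Za eZa !hmulNx hoppK -!hmulA (hmulA w) cyc ?hmulx1.
have Zb := onY b bY bX.
have onX f : f \in supp X -> f \notin supp Y -> Z f = X f.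
  move=> fX fY.
  have [u [v [w [uvw eXe eYb eZf]]]] :=
    triangle cX cY cZ qX qY qZ mXY fX fY bY bX eX eY ZS.
  have eYe : Y e = X f * u by rewrite -(hoppK (Y e)) -XYe eXe hoppK.
  by rewrite eZf Zb eYb eYe !hmulNx hoppK -!hmulA (hmulA u) uvw hmulx1.
exists Z; split; first by apply/circuits_of_coordsE.
  by apply: (off_supp ZS); rewrite setD11.
move=> f.
have [fX|fX] := boolP (f \in supp X); have [fY|fY] := boolP (f \in supp Y).
- have [fZ|fZ] := boolP (f \in supp Z).
    exact: (tetrahedron cX cY cZ qX qY qZ mXY aX aY bY bX eX eY ZS).
  (* [Z] avoids [f] as well as [e], so that [f] may play the role of [e]. *)
  have ZSf : supp Z \subset (supp X :|: supp Y) :\ f.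
    by rewrite subsetD1 fZ andbT (subset_trans ZS) ?subD1set.
  have [u [v [w [uvw eXf eYb eZa]]]] :=
    triangle cX cY cZ qX qY qZ mXY aX aY bY bX fX fY ZSf.
  have -> : Y f = - X f.
    have := cyc _ _ _ (cyc _ _ _ uvw) => vwu.
    by rewrite eXf hoppK -Za eZa Zb eYb !hmulNx hoppK -!hmulA (hmulA v) vwu hmulx1.
  by rewrite (notin_supp fZ); apply: haddxN.
- by rewrite (notin_supp fY); apply/haddx0E/onX.
- by rewrite (notin_supp fX); apply/hadd0xE/onY.
- have fZ : f \notin supp Z.
    apply: contraNN fX => /(subsetP ZS).
    by rewrite in_setD1 in_setU (negPf fY) orbF => /andP[].
  by rewrite !notin_supp //; apply/haddx0E.
Qed.

Lemma matroid_of_coords : left_matroid (circuits_of_coords q).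
Proof.
split.
- by case=> /circuit_neq0[x /suppP]; rewrite ffunE.
- move=> X r /circuits_of_coordsE[cX qX] r0; apply/circuits_of_coordsE.
  by rewrite supp_lscale //; split=> //; apply: compatible_lscale.
- move=> X Y /circuits_of_coordsE[cX qX] /circuits_of_coordsE[cY qY] XY.
  exact: compatible_proportional cX (circuit_sub cX cY XY) qX qY.
- by move=> X Y e CX CY; rewrite supports_of_coords; apply: coords_elim.
Qed.

End OfCoords.

Theorem theorem1 (E : finType) (N : matroid E) (H : skewHyperfieldType)
  (q : adjacent_bases N -> H) (C : set {ffun E -> H}) :
  [/\ left_matroid C, supports C = [set` circuits N]%classic
    & q = coords_of C]
  <->
  (quasi_Plucker q /\ C = circuits_of_coords q).
Proof.
split=> [[mC sC qC]|[qP ->]].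
  have comp X : C X -> compatible q X.
    by rewrite qC; apply: coords_of_compatible => //; apply: left_matroid_C2.
  split; first exact: quasi_Plucker_of_matroid mC sC comp.
  exact: circuits_of_matroid mC sC comp.
have mC := matroid_of_coords qP; have sC := supports_of_coords qP.
split=> //; apply: compatible_coords_uniq => D cD.
have [X [eX qX]] := vector_of_circuit qP cD; exists X; split=> //.
apply: coords_of_compatible sC (left_matroid_C2 mC) _.
by apply/circuits_of_coordsE; rewrite eX.
Qed.
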